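(* Minimal translation surfaces of type 2 in the Heisenberg group $\mathrm{Nil}_3$ are parameterized by $$r(x,y)=(x,0,u(x))*(v(y),y,0)=\Big(x+v(y),\,y,\,u(x)+\frac{xy}{2}\Big),$$ where (i) either $u(x)=\frac{a}{2(1+a^2)}\,x^2+bx+c$ and $v(y)=ay+d$, with $a,b,c,d\in\mathbb{R}$, (ii) or $u(x)=ax+u_0$ and $$v(y)=\frac{b}{2a+y}+\frac{c}{2(2a+y)}\left[(a+y)\sqrt{1+(a+y)^2}+\ln\left(a+y+\sqrt{1+(a+y)^2}\right)\right],$$ with $a,u_0,b,c\in\mathbb{R}$.
   Context: The Heisenberg group $\mathrm{Nil}_3$ is $\mathbb{R}^3$ with the group operation $$(x,y,z)*(\overline{x},\overline{y},\overline{z})=\Big(x+\overline{x},\ y+\overline{y},\ z+\overline{z}+\frac{x\overline{y}}{2}-\frac{\overline{x}y}{2}\Big),$$ equipped with the left invariant Riemannian metric $$\tilde g=dx^2+dy^2+\Big(dz+\tfrac12(y\,dx-x\,dy)\Big)^2.$$ A translation surface $M(\gamma_1,\gamma_2)$ in $\mathrm{Nil}_3$ is a surface parametrized by $r(x,y)=\gamma_1(x)*\gamma_2(y)$, where $\gamma_1,\gamma_2$ are curves lying in coordinate planes of $\mathbb{R}^3$. It is of type 2 when $\gamma_1(x)=(x,0,u(x))$ and $\gamma_2(y)=(v(y),y,0)$, with $u,v$ smooth functions of one variable. A surface immersed in $(\mathrm{Nil}_3,\tilde g)$ is minimal if its mean curvature $H=\frac12\mathrm{trace}(A)$ vanishes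 identically, where $A$ is the shape operator associated to a unit normal.
   Formalization: That the surfaces in (i) are minimal is stated only for d = 0, since for d ≠ 0 they never are (e.g. u = 0, v = 1); in (ii) the formula for v is asserted only where 2a + y ≠ 0, since it is undefined at y = −2a. *)

(* Defs.v *)
From HB Require Import structures.
From mathcomp Require Import all_boot all_order all_algebra.
From mathcomp Require Import all_classical all_reals all_analysis.

Set Implicit Arguments.
Unset Strict Implicit.
Unset Printing Implicit Defensive.

Import Order.TTheory GRing.Theory Num.Theory.
Import numFieldNormedType.Exports.

Local Open Scope classical_set_scope.
Local Open Scope ring_scope.

Section Riemannian.
Context {R : realType} {n : nat}.
Implicit Types (p X Y : 'rV[R]_n.+1) (g : 'rV[R]_n.+1 -> 'M[R]_n.+1).

(* A Riemannian metric on R^(n+1) is given by its Gram matrix [g p] in the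
   global coordinates; tangent vectors are row vectors of coordinates. *)
Definition metric_ip g p X Y : R := (X *m g p *m Y^T) 0 0.

Definition partial (h : 'rV[R]_n.+1 -> R) (i : 'I_n.+1) p : R :=
  'D_(delta_mx 0 i) h p.

(* Gamma^k_ij, for the Levi-Civita connection of g *)
Definition christoffel g (k i j : 'I_n.+1) p : R :=
  2^-1 * \sum_l invmx (g p) k l *
    (partial (fun q => g q j l) i p + partial (fun q => g q i l) j p
     - partial (fun q => g q i j) l p).

(* Covariant derivative at p of a vector field along a curve through p, where T
   is the velocity of the curve, and V and dV are the values of the field and
   of the derivative of its coordinates. *)
Definition covariant g p (T V dV : 'rV[R]_n.+1) : 'rV[R]_n.+1 :=
  \row_k (dV 0 k + \sum_i \sum_j christoffel g k i j p * T 0 i * V 0 j).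

Implicit Types (f N : R -> R -> 'rV[R]_n.+1).

Definition d1 f (x y : R) : 'rV[R]_n.+1 := derive1 (fun s => f s y) x.
Definition d2 f (x y : R) : 'rV[R]_n.+1 := derive1 (fun t => f x t) y.

Definition tangent_frame f (x y : R) : 'M[R]_(2, n.+1) :=
  col_mx (d1 f x y) (d2 f x y).

Definition immersed (I J : set R) f : Prop :=
  forall x y, I x -> J y -> row_free (tangent_frame f x y).

(* The rows are the covariant derivatives of N along the coordinate curves. *)
Definition normal_derivatives g f N (x y : R) : 'M[R]_(2, n.+1) :=
  col_mx (covariant g (f x y) (d1 f x y) (N x y) (d1 N x y))
         (covariant g (f x y) (d2 f x y) (N x y) (d2 N x y)).

(* Differentiability forbids sign changes of N on the rectangle I x J. *)
Definition unit_normal g (I J : set R) f N : Prop :=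
  forall x y, I x -> J y ->
    [/\ derivable (fun s => N s y) x 1, derivable (fun t => N x t) y 1,
        metric_ip g (f x y) (N x y) (N x y) = 1,
        metric_ip g (f x y) (N x y) (d1 f x y) = 0 &
        metric_ip g (f x y) (N x y) (d2 f x y) = 0].

(* [A] is the matrix, in the basis (f_x, f_y), of X |-> - nabla_X N; row i holds
   the coordinates of the image of the i-th basis vector. *)
Definition shape_operator g f N (x y : R) (A : 'M[R]_2) : Prop :=
  A *m tangent_frame f x y = - normal_derivatives g f N x y.

Definition mean_curvature g f N (x y H : R) : Prop :=
  exists2 A, shape_operator g f N x y A & H = 2^-1 * \tr A.

Definition minimal_surface g (I J : set R) f : Prop :=
  immersed I J f /\
  exists2 N, unit_normal g I J f N &
    forall x y, I x -> J y -> mean_curvature g f N x y 0.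

End Riemannian.

Section Heisenberg.
Context {R : realType}.

Definition pt (a b c : R) : 'rV[R]_3 := \row_(i < 3) [:: a; b; c]`_i.

Definition px (p : 'rV[R]_3) : R := p 0 0.
Definition py (p : 'rV[R]_3) : R := p 0 1.
Definition pz (p : 'rV[R]_3) : R := p 0 2.

Definition nil_mul (p q : 'rV[R]_3) : 'rV[R]_3 :=
  pt (px p + px q) (py p + py q)
     (pz p + pz q + px p * py q / 2 - px q * py p / 2).

(* The rows dx, dy, dz are the coordinate 1-forms, and theta^T *m theta is the
   Gram matrix of theta^2. *)
Definition nil_metric (p : 'rV[R]_3) : 'M[R]_3 :=
  let dx := pt 1 0 0 in let dy := pt 0 1 0 in let dz := pt 0 0 1 in
  let theta := dz + 2^-1 *: (py p *: dx - px p *: dy) in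
  dx^T *m dx + dy^T *m dy + theta^T *m theta.

Definition translation_surface (gamma1 gamma2 : R -> 'rV[R]_3) (x y : R) :
  'rV[R]_3 := nil_mul (gamma1 x) (gamma2 y).

Definition type2_surface (u v : R -> R) : R -> R -> 'rV[R]_3 :=
  translation_surface (fun x => pt x 0 (u x)) (fun y => pt (v y) y 0).

Definition open_interval (I : set R) : Prop :=
  [/\ open I, is_interval I & I !=set0].

Definition smooth_on (I : set R) (u : R -> R) : Prop :=
  forall k x, I x -> derivable (derive1n k u) x 1.

(* These surfaces are minimal only when d = 0. *)
Definition family_i (I J : set R) (u v : R -> R) (a b c d : R) : Prop :=
  (forall x, I x -> u x = a / (2 * (1 + a ^+ 2)) * x ^+ 2 + b * x + c) /\
  (forall y, J y -> v y = a * y + d).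

(* A smooth v may extend across the pole y = - 2 a of the formula, with a value
   there that the formula does not give. *)
Definition family_ii (I J : set R) (u v : R -> R) (a u0 b c : R) : Prop :=
  (forall x, I x -> u x = a * x + u0) /\
  (forall y, J y -> 2 * a + y != 0 ->
     v y = b / (2 * a + y) + c / (2 * (2 * a + y)) *
       ((a + y) * Num.sqrt (1 + (a + y) ^+ 2)
        + ln (a + y + Num.sqrt (1 + (a + y) ^+ 2)))).

End Heisenberg.

(* Main.v *)
Require Import Defs.
From mathcomp Require Import all_boot all_order all_algebra.
From mathcomp Require Import all_classical all_reals all_analysis.
From mathcomp Require Import ring lra.
Import Order.TTheory GRing.Theory Num.Theory.
Import numFieldNormedType.Exports.
Local Open Scope classical_set_scope.
Local Open Scope ring_scope.

(* In the left-invariant orthonormal frame the tangent vectors of the surface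
   are (1, 0, p) and (v', 1, q), where p = u' + y and q = (y v' - v) / 2, so
   the unit normal is a multiple of (- p, p v' - q, 1), and H = 0 reads
     (1 + v'^2 + q^2) u'' = (1 + p^2) (u' + y/2) v'' + v' + p q.
   For fixed y the right-hand side is a cubic in t = u'(x).  If u' is not
   constant then it takes all the values of an interval, so the coefficients
   divided by 1 + v'^2 + q^2 do not depend on y; those of t^3 and t^2 are v''
   and 5/2 y v'', whence v'' = 0, and then q = 0.  If u' = a is constant then
   w = (2a + y) v solves (1 + s^2) w'' = s w' with s = a + y, so that w' is a
   multiple of sqrt (1 + s^2). *)

(** * The Levi-Civita connection of the Heisenberg group *)

Section NilGeometry.
Context {R : realType}.
Implicit Types (p q X Y T V : 'rV[R]_3).

Lemma sum3 (F : 'I_3 -> R) : \sum_i F i = F 0 + F 1 + F 2.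
Proof.
rewrite !big_ord_recl big_ord0 addr0 addrA.
by congr (_ + F _ + F _); apply: val_inj.
Qed.

Lemma all3 (P : 'I_3 -> Prop) : P 0 -> P 1 -> P 2 -> forall i, P i.
Proof.
move=> P0 P1 P2 [[|[|[|//]]] hi].
- by rewrite (_ : Ordinal hi = 0)//; apply: val_inj.
- by rewrite (_ : Ordinal hi = 1)//; apply: val_inj.
- by rewrite (_ : Ordinal hi = 2)//; apply: val_inj.
Qed.

Lemma rV3P (X Y : 'rV[R]_3) :
  X 0 0 = Y 0 0 -> X 0 1 = Y 0 1 -> X 0 2 = Y 0 2 -> X = Y.
Proof. by move=> h0 h1 h2; apply/rowP; apply: all3. Qed.

Lemma pt0 (a b c : R) : pt a b c 0 0 = a. Proof. by rewrite mxE. Qed.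
Lemma pt1 (a b c : R) : pt a b c 0 1 = b. Proof. by rewrite mxE. Qed.
Lemma pt2 (a b c : R) : pt a b c 0 2 = c. Proof. by rewrite mxE. Qed.
Definition ptE := (pt0, pt1, pt2).

(** The coefficients of the contact form dz + (y dx - x dy) / 2, which completes dx, dy to a
    left-invariant orthonormal coframe. *)
Definition contact_row p : 'rV[R]_3 := pt (py p / 2) (- (px p / 2)) 1.

Lemma nil_metricE p i j : nil_metric p i j =
  (i == 0)%:R * (j == 0)%:R + (i == 1)%:R * (j == 1)%:R
  + contact_row p 0 i * contact_row p 0 j.
Proof.
rewrite /nil_metric !mxE !big_ord1 !mxE; elim/all3: i; elim/all3: j => /=;
  by field.
Qed.

(* The components of X in the left-invariant orthonormal frame are X 0 0, X 0 1
   and contact p X. *)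
Definition contact p X : R := X 0 2 + (py p * X 0 0 - px p * X 0 1) / 2.

Lemma metric_ipE p X Y : metric_ip nil_metric p X Y =
  X 0 0 * Y 0 0 + X 0 1 * Y 0 1 + contact p X * contact p Y.
Proof.
rewrite /metric_ip !mxE sum3 !mxE !sum3 !nil_metricE /contact_row !ptE.
by rewrite /contact /=; field.
Qed.

(** The inverse of the Gram matrix is the sum of e^T e over the dual orthonormal frame (1, 0, -
    y/2), (0, 1, x/2), (0, 0, 1); the right-hand side is that sum. For square matrices a right
    inverse is enough. *)
Lemma invmx_nil_metric p : invmx (nil_metric p) =
  \matrix_(i, j) ((i == j)%:R - (i == 2)%:R * (j == 2)%:R
    + (pt (- (py p / 2)) (px p / 2) 1 0 i * (j == 2)%:R
    + pt (- (py p / 2)) (px p / 2) 0 0 j * (i == 2)%:R)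
    + (i == 2)%:R * (j == 2)%:R * ((px p ^+ 2 + py p ^+ 2) / 4)).
Proof.
set G := \matrix_(i, j) _.
have GI : nil_metric p *m G = 1%:M.
  apply/matrixP => i j; rewrite !mxE sum3 !nil_metricE /G !mxE /contact_row.
  by elim/all3: i; elim/all3: j; rewrite ?ptE /=; by field.
have [ug _] := mulmx1_unit GI.
by rewrite -[LHS]mulmx1 -GI mulmxA mulVmx// mul1mx.
Qed.

Global Instance is_derive_coord (k : 'I_3) p X :
  is_derive p X (fun q => q 0 k : R) (X 0 k).
Proof.
have d : derivable (id : 'rV[R]_3 -> _) p X by [].
split; first by move/derivable_mxP : d; exact.
by have := derive_mx d; rewrite derive_id => /rowP/(_ k); rewrite mxE => <-.
Qed.

(** [contact_row] is affine in the base point; this is its linear part. *)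
Definition dcontact_row X : 'rV[R]_3 := pt (X 0 1 / 2) (- (X 0 0 / 2)) 0.

Lemma is_derive_contact_row p X i :
  is_derive p X (fun q => contact_row q 0 i) (dcontact_row X 0 i).
Proof.
rewrite /contact_row /dcontact_row /px /py; elim/all3: i => /=; rewrite !ptE.
- under eq_fun do rewrite ptE mulrC; rewrite mulrC; exact: is_deriveZ.
- under eq_fun do rewrite ptE mulrC; rewrite mulrC.
  by apply: is_deriveN; exact: is_deriveZ.
- under eq_fun do rewrite ptE; exact: is_derive_cst.
Qed.

Lemma partial_nil_metric p i j k :
  partial (fun q => nil_metric q i j) k p =
  dcontact_row (delta_mx 0 k) 0 i * contact_row p 0 j
  + contact_row p 0 i * dcontact_row (delta_mx 0 k) 0 j.
Proof.
rewrite /partial; under eq_fun do rewrite nil_metricE.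
have hi := is_derive_contact_row p (delta_mx 0 k) i.
have hj := is_derive_contact_row p (delta_mx 0 k) j.
pose c : R := (i == 0)%:R * (j == 0)%:R + (i == 1)%:R * (j == 1)%:R.
have h := is_deriveD (is_derive_cst c p (delta_mx 0 k)) (is_deriveM hi hj).
rewrite (@derive_val _ _ _ _ _ _ _ h) add0r /GRing.scale /=.
by rewrite addrC mulrC.
Qed.

(** The Christoffel sums regroup into contact components of [T] and [V], which are simple for the
    tangent vectors and the normal of a type 2 surface. *)
Lemma covariant_nil p T V dV :
  covariant nil_metric p T V dV =
  pt (dV 0 0 + (T 0 1 * contact p V + contact p T * V 0 1) / 2)
     (dV 0 1 - (T 0 0 * contact p V + contact p T * V 0 0) / 2)
     (dV 0 2 - py p * (T 0 1 * contact p V + contact p T * V 0 1) / 4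
      - px p * (T 0 0 * contact p V + contact p T * V 0 0) / 4).
Proof.
apply: rV3P; rewrite ?ptE /covariant !mxE !sum3 /christoffel !sum3;
  rewrite !partial_nil_metric invmx_nil_metric !mxE /= /contact; by field.
Qed.

(** The Christoffel terms in [covariant_nil] form a vector killed by the contact form. *)
Lemma contact_covariant p T V dV :
  contact p (covariant nil_metric p T V dV) = contact p dV.
Proof. by rewrite covariant_nil /contact !ptE; field. Qed.

End NilGeometry.

(** * Differentiation rules in one real variable *)

Section RealDerivatives.
Set Implicit Arguments.
Unset Strict Implicit.
Context {R : realType}.

(* Unlike [is_derive], not a class: [apply:] must not run instance search on
   the premises of the rules below. *)
Definition has_derive (V : normedModType R) (f : R -> V) (x : R) (d : V) :=
  is_derive x 1 f d.

Implicit Types (f g h : R -> R) (x c df dg : R) (I : set R).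

Lemma has_derive_eq f x df dg :
  has_derive f x df -> df = dg -> has_derive f x dg.
Proof. by move=> ? <-. Qed.

Lemma has_deriveC x c : has_derive (fun _ : R => c) x 0.
Proof. exact: is_derive_cst. Qed.

Lemma has_deriveI x : has_derive (fun s : R => s) x 1.
Proof. exact: is_derive_id. Qed.

Lemma has_deriveD f g x df dg : has_derive f x df -> has_derive g x dg ->
  has_derive (fun s => f s + g s) x (df + dg).
Proof. exact: is_deriveD. Qed.

Lemma has_deriveN f x df : has_derive f x df ->
  has_derive (fun s => - f s) x (- df).
Proof. exact: is_deriveN. Qed.

Lemma has_deriveM f g x df dg : has_derive f x df -> has_derive g x dg ->
  has_derive (fun s => f s * g s) x (df * g x + f x * dg).
Proof.
by move=> hf hg; rewrite addrC [df * _]mulrC; exact: (is_deriveM hf hg).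
Qed.

Lemma has_deriveX2 f x df : has_derive f x df ->
  has_derive (fun s => f s ^+ 2) x (2 * f x * df).
Proof.
move=> hf; under eq_fun do rewrite expr2.
by apply: has_derive_eq; [exact: (has_deriveM hf hf)|ring].
Qed.

Lemma has_deriveV f x df : has_derive f x df -> f x != 0 ->
  has_derive (fun s => (f s)^-1) x (- df / f x ^+ 2).
Proof.
move=> hf f0; rewrite mulrC mulrN -mulNr; exact: (is_deriveV f0 hf).
Qed.

Lemma has_derive_sqrt f x df : has_derive f x df -> 0 < f x ->
  has_derive (fun s => Num.sqrt (f s)) x (df / (2 * Num.sqrt (f x))).
Proof.
move=> hf f0; rewrite mulrC.
by apply: (@is_derive1_comp _ Num.sqrt f) => //; exact: is_derive1_sqrt.
Qed.

Lemma has_derive_ln f x df : has_derive f x df -> 0 < f x ->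
  has_derive (fun s => ln (f s)) x (df / f x).
Proof.
move=> hf f0; rewrite mulrC.
by apply: (@is_derive1_comp _ (@ln R) f) => //; exact: is_derive1_ln.
Qed.

Lemma has_derive_pt f g h x df dg dh : has_derive f x df ->
  has_derive g x dg -> has_derive h x dh ->
  has_derive (fun s => pt (f s) (g s) (h s)) x (pt df dg dh).
Proof.
move=> hf hg hh.
have d : derivable (fun s => pt (f s) (g s) (h s)) x 1.
  apply/derivable_mxP => i j; rewrite (ord1 i).
  by elim/all3: j; under eq_fun do rewrite ptE; [case: hf|case: hg|case: hh].
split => //; rewrite derive_mx//; apply: rV3P; rewrite !mxE /=.
- by under eq_fun do rewrite ptE; case: hf.
- by under eq_fun do rewrite ptE; case: hg.
- by under eq_fun do rewrite ptE; case: hh.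
Qed.

Lemma has_derive_entry (F : R -> 'rV[R]_3) x j : derivable F x 1 ->
  has_derive (fun s => F s 0 j) x (derive1 F x 0 j).
Proof.
move=> d; split; first by move/derivable_mxP : d; exact.
by rewrite derive1E derive_mx// !mxE.
Qed.

(** Differentiation is local: this transports derivatives along formulas that are known on [I] or
    [J] only. *)
Lemma has_derive_open (V : normedModType R) I (f g : R -> V) x (df : V) :
  open I -> I x -> (forall s, I s -> f s = g s) -> has_derive f x df ->
  has_derive g x df.
Proof.
move=> oI Ix fg; apply: near_eq_is_derive.
by apply: filterS (open_nbhs_nbhs (conj oI Ix)).
Qed.

Lemma has_derive_unique (V : normedModType R) (f : R -> V) x (d e : V) :
  has_derive f x d -> has_derive f x e -> d = e.
Proof. by move=> [_ <-] [_ <-]. Qed.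

Lemma has_derive_smooth I f k x : smooth_on I f -> I x ->
  has_derive (derive1n k f) x (derive1n k.+1 f x).
Proof. by move=> sf Ix; rewrite derive1nS derive1E; apply/derivableP/sf. Qed.

End RealDerivatives.

(** The context is searched first, so that derivatives of composite functions such as [tx] or [ny],
    placed there beforehand, are used as they are. *)
Ltac deriv := repeat first
  [ eassumption | apply: has_deriveC | apply: has_deriveI
  | apply: has_deriveD | apply: has_deriveN | apply: has_deriveX2
  | apply: has_deriveM ].

Ltac compute_derive := apply: has_derive_eq; [by deriv | rewrite //=].

(** * The minimality equation of a type 2 surface *)

Section MinimalEquation.
Set Implicit Arguments.
Unset Strict Implicit.
Context {R : realType}.
Variables (I J : set R) (u u1 u2 v v1 v2 : R -> R).
Hypotheses (oI : open I) (oJ : open J).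
Hypotheses (is_u : forall x, I x -> has_derive u x (u1 x)).
Hypotheses (is_u1 : forall x, I x -> has_derive u1 x (u2 x)).
Hypotheses (is_v : forall y, J y -> has_derive v y (v1 y)).
Hypotheses (is_v1 : forall y, J y -> has_derive v1 y (v2 y)).
Implicit Types (x y k : R).

Local Notation f := (type2_surface u v).

(* The contact components p and q of the partial derivatives of f are tx and
   ty; the vector (- tx, ny, 1) of the left-invariant frame is normal to the
   surface and has squared norm nsq. *)
Definition tx x y : R := u1 x + y.
Definition ty y : R := (y * v1 y - v y) / 2.
Definition ny x y : R := tx x y * v1 y - ty y.
Definition nsq x y : R := 1 + tx x y ^+ 2 + ny x y ^+ 2.

Definition frame_x x y : 'rV[R]_3 := pt 1 0 (u1 x + y / 2).
Definition frame_y x y : 'rV[R]_3 := pt (v1 y) 1 (x / 2).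

Definition type2_equation x y : R :=
  (1 + v1 y ^+ 2 + ty y ^+ 2) * u2 x
  - (1 + tx x y ^+ 2) * (u1 x + y / 2) * v2 y - v1 y - tx x y * ty y.

(* The vector k (- tx, ny, 1) of the left-invariant frame, in coordinates. *)
Definition normal x y k : 'rV[R]_3 :=
  pt (- (tx x y * k)) (ny x y * k)
     (k + (y * (tx x y * k) + (x + v y) * (ny x y * k)) / 2).

Lemma type2_surfaceE x y : f x y = pt (x + v y) y (u x + x * y / 2).
Proof.
rewrite /type2_surface /translation_surface /nil_mul /px /py /pz !ptE.
by congr (pt _ _ _); field.
Qed.

Lemma d1_type2 x y : I x -> d1 f x y = frame_x x y.
Proof.
move=> /is_u hx; rewrite /d1 derive1E.
under eq_fun do rewrite type2_surfaceE.
suff [] : has_derive (fun s => pt (s + v y) y (u s + s * y / 2)) x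
    (frame_x x y).
  by [].
by apply: has_derive_pt; compute_derive; field.
Qed.

Lemma d2_type2 x y : J y -> d2 f x y = frame_y x y.
Proof.
move=> /is_v hy; rewrite /d2 derive1E.
under eq_fun do rewrite type2_surfaceE.
suff [] : has_derive (fun t => pt (x + v t) t (u x + x * t / 2)) y
    (frame_y x y).
  by [].
by apply: has_derive_pt; compute_derive; field.
Qed.

Lemma nsq_gt0 x y : 0 < nsq x y.
Proof. by rewrite /nsq -addrA ltr_pwDl// addr_ge0 ?sqr_ge0. Qed.

Lemma has_derive_tx1 x y : I x -> has_derive (tx ^~ y) x (u2 x).
Proof.
by move=> /is_u1 hx; rewrite /tx; compute_derive; rewrite addr0.
Qed.

Lemma has_derive_tx2 x y : has_derive (tx x) y 1.
Proof. by rewrite /tx; compute_derive; rewrite add0r. Qed.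

Lemma has_derive_ny1 x y : I x -> has_derive (ny ^~ y) x (u2 x * v1 y).
Proof.
move=> Ix; have hp := has_derive_tx1 y Ix; rewrite /ny; compute_derive; ring.
Qed.

Definition dny x y : R := v1 y + tx x y * v2 y - y * v2 y / 2.

Lemma has_derive_ny2 x y : J y -> has_derive (ny x) y (dny x y).
Proof.
move=> Jy; have h0 := is_v Jy; have h1 := is_v1 Jy.
have hp := has_derive_tx2 x y.
by rewrite /ny /ty; compute_derive; rewrite /dny; field.
Qed.

Lemma has_derive_nsq1 x y : I x ->
  has_derive (nsq ^~ y) x (2 * (tx x y + ny x y * v1 y) * u2 x).
Proof.
move=> Ix; have hp := has_derive_tx1 y Ix; have hm := has_derive_ny1 y Ix.
rewrite /nsq; compute_derive; ring.
Qed.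

Lemma has_derive_nsq2 x y : J y ->
  has_derive (nsq x) y (2 * (tx x y + ny x y * dny x y)).
Proof.
move=> Jy; have hp := has_derive_tx2 x y; have hm := has_derive_ny2 x Jy.
rewrite /nsq; compute_derive; ring.
Qed.

Lemma col_mx0 (X Y : 'rV[R]_3) j : (col_mx X Y : 'M[R]_(2, 3)) 0 j = X 0 j.
Proof. by rewrite -(col_mxEu X Y); congr (col_mx X Y _ _); apply: val_inj. Qed.

Lemma col_mx1 (X Y : 'rV[R]_3) j : (col_mx X Y : 'M[R]_(2, 3)) 1 j = Y 0 j.
Proof. by rewrite -(col_mxEd X Y); congr (col_mx X Y _ _); apply: val_inj. Qed.

Lemma sum2 (F : 'I_2 -> R) : \sum_i F i = F 0 + F 1.
Proof.
rewrite !big_ord_recl big_ord0 addr0.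
by congr (_ + F _); apply: val_inj.
Qed.

Lemma mul_col_mxE i j (A : 'M[R]_2) (X Y : 'rV[R]_3) :
  (A *m (col_mx X Y : 'M[R]_(2, 3))) i j = A i 0 * X 0 j + A i 1 * Y 0 j.
Proof. by rewrite mxE sum2 col_mx0 col_mx1. Qed.

(** Here [a] and [b] are the x-derivatives of tx nu and ny nu, by the product rule. The third
    coordinate of [normal] depends on x also through x + v y, hence the isolated term ny nu. *)
Lemma d1_normal (N : R -> R -> 'rV[R]_3) (nu : R -> R -> R) x y k1 :
  I x -> (forall s, I s -> N s y = normal s y (nu s y)) ->
  has_derive (nu ^~ y) x k1 ->
  d1 N x y =
    let a := u2 x * nu x y + tx x y * k1 in
    let b := u2 x * v1 y * nu x y + ny x y * k1 in
    pt (- a) b (k1 + (y * a + ny x y * nu x y + (x + v y) * b) / 2).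
Proof.
move=> Ix Nn hk; rewrite /d1 derive1E; set D := (X in _ = X).
suff [] : has_derive (N ^~ y) x D by [].
have hp := has_derive_tx1 y Ix; have hm := has_derive_ny1 y Ix.
apply: (has_derive_open oI Ix (f := fun s => normal s y (nu s y))).
  by move=> s /Nn.
by apply: has_derive_pt; compute_derive; field.
Qed.

Lemma d2_normal (N : R -> R -> 'rV[R]_3) (nu : R -> R -> R) x y k2 :
  J y -> (forall t, J t -> N x t = normal x t (nu x t)) ->
  has_derive (nu x) y k2 ->
  d2 N x y =
    let a := nu x y + tx x y * k2 in
    let b := dny x y * nu x y + ny x y * k2 in
    pt (- a) b (k2 + (tx x y * nu x y + y * a + v1 y * (ny x y * nu x y)
                      + (x + v y) * b) / 2).
Proof.
move=> Jy Nn hk; rewrite /d2 derive1E; set D := (X in _ = X).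
suff [] : has_derive (N x) y D by [].
have hp := has_derive_tx2 x y; have hm := has_derive_ny2 x Jy.
have hv := is_v Jy.
apply: (has_derive_open oJ Jy (f := fun t => normal x t (nu x t))).
  by move=> t /Nn.
by apply: has_derive_pt; compute_derive; field.
Qed.

(* cx and cy stand for the covariant derivatives of a unit normal; the
   hypotheses say that they are tangent to the surface. *)
Lemma traceless_shapeP x y (cx cy : 'rV[R]_3) :
  contact (f x y) cx = tx x y * cx 0 0 - ny x y * cx 0 1 ->
  contact (f x y) cy = tx x y * cy 0 0 - ny x y * cy 0 1 ->
  (exists2 A : 'M[R]_2,
    A *m (col_mx (frame_x x y) (frame_y x y) : 'M[R]_(2, 3)) =
      - (col_mx cx cy : 'M[R]_(2, 3)) & 0 = 2^-1 * \tr A) <->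
  cx 0 0 - v1 y * cx 0 1 + cy 0 1 = 0.
Proof.
rewrite /contact /px /py type2_surfaceE !ptE => hx hy.
have tr2 (A : 'M[R]_2) : \tr A = A 0 0 + A 1 1 by rewrite /mxtrace sum2.
split=> [[A hA]|h0].
  have e i j : A i 0 * frame_x x y 0 j + A i 1 * frame_y x y 0 j =
      - (col_mx cx cy : 'M[R]_(2, 3)) i j.
    by rewrite -mul_col_mxE hA mxE.
  (* The second coordinates of the frame vectors are 0 and 1, so the entries (0, 1) and (1, 1) give
     the second column of [A]; then (0, 0) gives [A 0 0], and the trace is known. *)
  have := (e 0 0, e 0 1, e 1 1); rewrite !ptE !col_mx0 !col_mx1 tr2.
  move=> [[e00 e01] e11] htr.
  have a01 : A 0 1 = - cx 0 1 by lra.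
  have a11 : A 1 1 = - cy 0 1 by lra.
  by move: e00 htr; rewrite a01 a11; lra.
(* The first two coordinates of the frame vectors, (1, 0) and (v1, 1), force these entries. The
   third coordinates then agree because [cx] and [cy] are tangent. *)
exists (\matrix_(i, j) if i == 0 then
    (if j == 0 then - cx 0 0 + v1 y * cx 0 1 else - cx 0 1)
  else (if j == 0 then - cy 0 0 + v1 y * cy 0 1 else - cy 0 1)); last first.
  by rewrite tr2 !mxE /=; lra.
have cx2 : cx 0 2 = tx x y * cx 0 0 - ny x y * cx 0 1
  - (y * cx 0 0 - (x + v y) * cx 0 1) / 2 by lra.
have cy2 : cy 0 2 = tx x y * cy 0 0 - ny x y * cy 0 1
  - (y * cy 0 0 - (x + v y) * cy 0 1) / 2 by lra.
apply/matrixP => i j; rewrite mul_col_mxE [RHS]mxE.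
have [->|->] : i = 0 \/ i = 1.
  by case: i => [[|[|//]] hi]; [left|right]; apply: val_inj.
- rewrite col_mx0; elim/all3: j; rewrite ?ptE !mxE /= ?cx2 /ny /tx /ty;
    by field.
- rewrite col_mx1; elim/all3: j; rewrite ?ptE !mxE /= ?cy2 /ny /tx /ty;
    by field.
Qed.


Lemma contact_frame_x x y : contact (f x y) (frame_x x y) = tx x y.
Proof. by rewrite /contact /px /py type2_surfaceE !ptE /tx; field. Qed.

Lemma contact_frame_y x y : contact (f x y) (frame_y x y) = ty y.
Proof. by rewrite /contact /px /py type2_surfaceE !ptE /ty; field. Qed.

Lemma contact_normal x y k : contact (f x y) (normal x y k) = k.
Proof. by rewrite /contact /px /py type2_surfaceE !ptE /=; field. Qed.

(** The trace condition, multiplied by [nsq], becomes - nu times [type2_equation] once the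
    derivatives of [nu] are eliminated; both [nsq] and [nu] are nonzero. *)
Lemma mean_curvature_type2 (N : R -> R -> 'rV[R]_3) (nu : R -> R -> R)
    x y k1 k2 :
  (forall s t, I s -> J t -> N s t = normal s t (nu s t)) ->
  (forall s t, I s -> J t -> nu s t ^+ 2 * nsq s t = 1) ->
  I x -> J y -> has_derive (nu ^~ y) x k1 -> has_derive (nu x) y k2 ->
  mean_curvature nil_metric f N x y 0 <-> type2_equation x y = 0.
Proof.
move=> Nn nuW Ix Jy hk1 hk2.
have nu0 : nu x y != 0.
  by apply/eqP => e; have := nuW x y Ix Jy; rewrite e; lra.
(* Differentiate nu^2 nsq = 1 in x and cancel one factor nu; [wk2] is the same in y. *)
have wk1 : k1 * nsq x y = - (nu x y * ((tx x y + ny x y * v1 y) * u2 x)).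
  have hW := has_derive_nsq1 y Ix.
  have h1 : has_derive (fun s => nu s y ^+ 2 * nsq s y) x 0.
    apply: (has_derive_open oI Ix _ (has_deriveC x 1)) => s Is.
    by rewrite nuW.
  have := has_derive_unique (has_deriveM (has_deriveX2 hk1) hW) h1.
  by move=> /= e; apply: (mulfI nu0); move: e; lra.
have wk2 : k2 * nsq x y = - (nu x y * (tx x y + ny x y * dny x y)).
  have hW := has_derive_nsq2 x Jy.
  have h1 : has_derive (fun t => nu x t ^+ 2 * nsq x t) y 0.
    apply: (has_derive_open oJ Jy _ (has_deriveC y 1)) => s Is.
    by rewrite nuW.
  have := has_derive_unique (has_deriveM (has_deriveX2 hk2) hW) h1.
  by move=> /= e; apply: (mulfI nu0); move: e; lra.
have dN1 := d1_normal Ix (fun s Is => Nn s y Is Jy) hk1.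
have dN2 := d2_normal Jy (fun t Jt => Nn x t Ix Jt) hk2.
rewrite /mean_curvature /shape_operator /tangent_frame /normal_derivatives.
rewrite d1_type2// d2_type2//.
(* The first two goals say that the covariant derivatives of the unit normal are tangent; they
   follow from [wk1] and [wk2]. *)
apply: iff_trans (traceless_shapeP _ _) _.
- rewrite contact_covariant covariant_nil dN1 Nn// !ptE.
  rewrite contact_normal contact_frame_x.
  rewrite /contact /px /py type2_surfaceE !ptE.
  by move: wk1; rewrite /nsq; lra.
- rewrite contact_covariant covariant_nil dN2 Nn// !ptE.
  rewrite contact_normal contact_frame_y.
  rewrite /contact /px /py type2_surfaceE !ptE.
  by move: wk2; rewrite /nsq; lra.
rewrite !covariant_nil dN1 dN2 Nn// !ptE !contact_normal.
rewrite contact_frame_x contact_frame_y.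
set H := (X in X = 0 <-> _).
have HE : H * nsq x y = - (nu x y * type2_equation x y).
  (* The terms in [k1] and [k2] are split off so that each meets its factor [nsq] and can be
     replaced. *)
  have -> : H * nsq x y =
      (H - (- tx x y * k1 - v1 y * (ny x y * k1) + ny x y * k2)) * nsq x y
      + (- (tx x y + v1 y * ny x y)) * (k1 * nsq x y)
      + ny x y * (k2 * nsq x y).
    by ring.
  rewrite wk1 wk2 /H /type2_equation /nsq /dny /ny /tx; by field.
have W0 := lt0r_neq0 (nsq_gt0 x y).
split=> h; apply/eqP.
- by move/eqP: HE; rewrite h mul0r eq_sym oppr_eq0 mulf_eq0 (negbTE nu0).
- by move/eqP: HE; rewrite h mulr0 oppr0 mulf_eq0 (negbTE W0) orbF.
Qed.


(** The first two coordinates of the frame vectors form a unitriangular matrix; its inverse, padded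
    by a zero row, is a right inverse of the frame. *)
Lemma type2_immersed : immersed I J f.
Proof.
move=> x y Ix Jy; rewrite /tangent_frame d1_type2// d2_type2//; apply/row_freeP.
exists (\matrix_(i < 3, j < 2) (if i == 0 then (j == 0)%:R
  else if i == 1 then (if j == 0 then - v1 y else 1) else 0)).
apply/matrixP => i j; rewrite mxE sum3.
have two (k : 'I_2) : k = 0 \/ k = 1.
  by case: k => [[|[|//]] hi]; [left|right]; apply: val_inj.
by have [->|->] := two i; have [->|->] := two j;
  rewrite ?col_mx0 ?col_mx1 !mxE /=; ring.
Qed.

(** Orthogonality to the two frame vectors is a linear system that expresses [N] through its contact
    component. That component serves as nu and inherits partial derivatives from [N]. *)
Lemma unit_normal_unique (N : R -> R -> 'rV[R]_3) :
  unit_normal nil_metric I J f N ->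
  exists nu : R -> R -> R,
  [/\ forall s t, I s -> J t -> N s t = normal s t (nu s t),
      forall s t, I s -> J t -> nu s t ^+ 2 * nsq s t = 1,
      forall x y, I x -> J y -> exists k, has_derive (nu ^~ y) x k &
      forall x y, I x -> J y -> exists k, has_derive (nu x) y k].
Proof.
move=> hN; exists (fun s t => contact (f s t) (N s t)).
have Nn s t : I s -> J t -> N s t = normal s t (contact (f s t) (N s t)).
  move=> Is Jt; have [_ _ _] := hN s t Is Jt.
  rewrite !metric_ipE d1_type2// d2_type2// contact_frame_x contact_frame_y.
  rewrite !ptE => e1 e2.
  have N0 : N s t 0 0 = - (tx s t * contact (f s t) (N s t)) by move: e1; lra.
  have N1 : N s t 0 1 = ny s t * contact (f s t) (N s t).
    by move: e2; rewrite N0 /ny; lra.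
  apply: rV3P; rewrite ?ptE -?N0 -?N1//.
  by rewrite -[tx s t * _]opprK -N0 /contact /px /py type2_surfaceE !ptE; field.
split => //.
- move=> s t Is Jt; have [_ _ + _ _] := hN s t Is Jt.
  rewrite metric_ipE {1 2 3 4}Nn// !ptE => <-; rewrite /nsq; ring.
- move=> x y Ix Jy; have [/has_derive_entry d _ _ _ _] := hN x y Ix Jy.
  have := (d 0, d 1, d 2) => -[[d0 d1] d2].
  rewrite /contact /px /py; eexists.
  under eq_fun do rewrite type2_surfaceE !ptE.
  by deriv.
- move=> x y Ix Jy; have [_ /has_derive_entry d _ _ _] := hN x y Ix Jy.
  have := (d 0, d 1, d 2) => -[[d0 d1] d2].
  have hv := is_v Jy.
  rewrite /contact /px /py; eexists.
  under eq_fun do rewrite type2_surfaceE !ptE.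
  by deriv.
Qed.

Lemma normal_unit_normal (nu : R -> R -> R) :
  (forall s t, I s -> J t -> nu s t ^+ 2 * nsq s t = 1) ->
  (forall x y, I x -> J y -> exists k, has_derive (nu ^~ y) x k) ->
  (forall x y, I x -> J y -> exists k, has_derive (nu x) y k) ->
  unit_normal nil_metric I J f (fun x y => normal x y (nu x y)).
Proof.
move=> nuW nu1 nu2 x y Ix Jy; split.
- have [k hk] := nu1 x y Ix Jy.
  have hp := has_derive_tx1 y Ix; have hm := has_derive_ny1 y Ix.
  suff [d [+ _]] : exists d, has_derive (fun s => normal s y (nu s y)) x d.
    by [].
  by eexists; apply: has_derive_pt; deriv.
- have [k hk] := nu2 x y Ix Jy.
  have hp := has_derive_tx2 x y; have hm := has_derive_ny2 x Jy.
  have hv := is_v Jy.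
  suff [d [+ _]] : exists d, has_derive (fun t => normal x t (nu x t)) y d.
    by [].
  by eexists; apply: has_derive_pt; deriv.
- by rewrite metric_ipE contact_normal !ptE -(nuW x y)// /nsq; ring.
- by rewrite metric_ipE d1_type2// contact_normal contact_frame_x !ptE; ring.
- rewrite metric_ipE d2_type2// contact_normal contact_frame_y !ptE /ny; ring.
Qed.

(** From left to right the given unit normal may have either sign, as only nu^2 nsq = 1 is used.
    From right to left the normal with nu = 1 / sqrt nsq is supplied. *)
Lemma minimal_type2 : minimal_surface nil_metric I J f <->
  forall x y, I x -> J y -> type2_equation x y = 0.
Proof.
split.
  move=> [_ [N /unit_normal_unique[nu [Nn nuW nu1 nu2]] H0]] x y Ix Jy.
  have [k1 hk1] := nu1 x y Ix Jy; have [k2 hk2] := nu2 x y Ix Jy.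
  by apply/(mean_curvature_type2 Nn nuW Ix Jy hk1 hk2); exact: H0.
move=> E0; split; first exact: type2_immersed.
pose nu x y := (Num.sqrt (nsq x y))^-1.
have sW0 x y : Num.sqrt (nsq x y) != 0.
  by rewrite gt_eqF// sqrtr_gt0 nsq_gt0.
have nuW s t : I s -> J t -> nu s t ^+ 2 * nsq s t = 1.
  move=> _ _; rewrite /nu exprVn sqr_sqrtr ?ltW ?nsq_gt0//.
  by rewrite mulVf// gt_eqF// nsq_gt0.
have nu1 x y : I x -> J y -> exists k, has_derive (nu ^~ y) x k.
  move=> Ix Jy; have hW := has_derive_sqrt (has_derive_nsq1 y Ix) (nsq_gt0 x y).
  by eexists; exact: (has_deriveV hW (sW0 x y)).
have nu2 x y : I x -> J y -> exists k, has_derive (nu x) y k.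
  move=> Ix Jy; have hW := has_derive_sqrt (has_derive_nsq2 x Jy) (nsq_gt0 x y).
  by eexists; exact: (has_deriveV hW (sW0 x y)).
exists (fun x y => normal x y (nu x y)); first exact: normal_unit_normal.
move=> x y Ix Jy.
have [k1 hk1] := nu1 x y Ix Jy; have [k2 hk2] := nu2 x y Ix Jy.
have := mean_curvature_type2 (fun _ _ _ _ => erefl) nuW Ix Jy hk1 hk2.
by move=> ->; exact: E0.
Qed.

End MinimalEquation.

(** * Calculus on intervals, and vanishing of cubics *)

Section IntervalCalculus.
Set Implicit Arguments.
Unset Strict Implicit.
Context {R : realType}.
Implicit Types (I : set R) (f g d : R -> R).

Lemma has_derive_continuous f x (df : R) :
  has_derive f x df -> {for x, continuous f}.
Proof.
by move=> [? _]; apply: differentiable_continuous; apply/derivable1_diffP.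
Qed.

Lemma has_derive_within I f d a b : is_interval I ->
  (forall x, I x -> has_derive f x (d x)) -> I a -> I b ->
  {within `[a, b], continuous f}.
Proof.
move=> iI df Ia Ib; apply: continuous_in_subspaceT => x /set_mem /=.
rewrite in_itv /= => xab; apply: (has_derive_continuous (df x _)).
exact: iI Ia Ib _ xab.
Qed.

Lemma has_derive0_cst I f : is_interval I ->
  (forall x, I x -> has_derive f x 0) -> forall x y, I x -> I y -> f x = f y.
Proof.
move=> iI df.
suff le x y : x <= y -> I x -> I y -> f x = f y.
  by move=> x y Ix Iy; have [/le->|/ltW/le->] := leP x y.
move=> xy Ix Iy; apply/eqP; rewrite eq_sym -subr_eq0; apply/eqP.
have cf := has_derive_within iI df Ix Iy.
have [|z _ ->] := @MVT_segment R f (cst 0) x y xy _ cf.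
  move=> z; rewrite in_itv /= => /andP[xz zy].
  by apply: df; apply: iI Ix Iy _ _; rewrite !ltW.
by rewrite mul0r.
Qed.

Lemma primitive_unique I f g d : is_interval I -> I !=set0 ->
  (forall x, I x -> has_derive f x (d x)) ->
  (forall x, I x -> has_derive g x (d x)) ->
  exists c, forall x, I x -> f x = g x + c.
Proof.
move=> iI [x0 Ix0] df dg; exists (f x0 - g x0) => x Ix.
suff e : f x - g x = f x0 - g x0 by rewrite -e; ring.
apply: (@has_derive0_cst I (fun s => f s - g s) iI) => // s Is.
have hf := df s Is; have hg := dg s Is.
by compute_derive; rewrite subrr.
Qed.

(** Parametrizing the intermediate value by [t] treats increasing and decreasing end values alike;
    exchanging x and y turns [t] into 1 - t. *)
Lemma has_derive_IVT I f d x y t : is_interval I ->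
  (forall x, I x -> has_derive f x (d x)) -> I x -> I y -> 0 <= t <= 1 ->
  exists2 z, I z & f z = f x + t * (f y - f x).
Proof.
move=> iI df; wlog xy : x y t / x <= y.
  move=> H Ix Iy t01; have [xy|/ltW yx] := leP x y; first exact: H.
  have t01' : 0 <= 1 - t <= 1 by lra.
  have [z Iz fz] := H y x (1 - t) yx Iy Ix t01'.
  by exists z => //; rewrite fz; ring.
move=> Ix Iy t01; have := has_derive_within iI df Ix Iy.
move=> /(IVT xy (v := f x + t * (f y - f x)))[|z].
  rewrite ge_min le_max.
  by have [h|/ltW h] := leP (f x) (f y); apply/andP; split; apply/orP;
    [left|right|right|left]; nra.
by rewrite in_itv /= => zxy; exists z => //; exact: iI Ix Iy _ zxy.
Qed.

(** Four equally spaced zeros suffice: their third difference is a multiple of c3 h^3, and the lower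
    coefficients follow in turn from second and first differences. *)
Lemma cubic_eq0 (c0 c1 c2 c3 a h : R) : h != 0 ->
  (forall t, 0 <= t <= 1 ->
     let z := a + t * h in c3 * z ^+ 3 + c2 * z ^+ 2 + c1 * z + c0 = 0) ->
  [/\ c3 = 0, c2 = 0, c1 = 0 & c0 = 0].
Proof.
move=> h0 H.
have e0 := H 0 ltac:(lra); have e1 := H (1 / 3) ltac:(lra).
have e2 := H (2 / 3) ltac:(lra); have e3 := H 1 ltac:(lra).
move: e0 e1 e2 e3 => /= e0 e1 e2 e3.
have c30 : c3 = 0.
  apply: (mulIf (expf_neq0 3 h0)); rewrite mul0r; lra.
have c20 : c2 = 0.
  by apply: (mulIf (expf_neq0 2 h0)); move: e0 e1 e2; rewrite c30 mul0r; lra.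
have c10 : c1 = 0.
  by apply: (mulIf h0); move: e0 e1; rewrite c30 c20 mul0r; lra.
by split => //; move: e0; rewrite c30 c20 c10; lra.
Qed.

Lemma open_other_point I x : open I -> I x -> exists2 y, I y & y != x.
Proof.
move=> oI Ix; have : \forall y \near x, I y.
  exact: (open_nbhs_nbhs (conj oI Ix)).
move=> /nbhs_ballP[e /= e0 He]; exists (x + e / 2).
  apply: He; rewrite /ball /= opprD addNKr normrN gtr0_norm; lra.
by rewrite -subr_eq0; apply/lt0r_neq0; lra.
Qed.

(** Both values are limits along the punctured neighbourhood, and limits are unique. This carries
    the formula of family (ii) across its pole. *)
Lemma continuous_punctured_eq (J : set R) f g y0 : open J -> J y0 ->
  {for y0, continuous f} -> {for y0, continuous g} ->
  (forall y, J y -> y != y0 -> f y = g y) -> f y0 = g y0.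
Proof.
move=> oJ Jy0 cf cg fg.
have cf' : f @ y0^' --> f y0.
  exact: cvg_trans (cvg_app _ (@cvg_within _ _ _ _)) cf.
have cg' : g @ y0^' --> g y0.
  exact: cvg_trans (cvg_app _ (@cvg_within _ _ _ _)) cg.
apply: (norm_cvg_unique cf'); apply: cvg_trans cg'; apply: near_eq_cvg.
have Jy : \forall y \near y0, J y by exact: (open_nbhs_nbhs (conj oJ Jy0)).
by apply: filterS Jy => y Jy yy0; rewrite fg.
Qed.

End IntervalCalculus.

(** * Solving the equation, and checking both families *)

Section Classification.
Set Implicit Arguments.
Unset Strict Implicit.
Context {R : realType}.
Variables (I J : set R) (u u1 u2 v v1 v2 : R -> R).
Hypotheses (hI : open_interval I) (hJ : open_interval J).
Hypotheses (is_u : forall x, I x -> has_derive u x (u1 x)).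
Hypotheses (is_u1 : forall x, I x -> has_derive u1 x (u2 x)).
Hypotheses (is_v : forall y, J y -> has_derive v y (v1 y)).
Hypotheses (is_v1 : forall y, J y -> has_derive v1 y (v2 y)).

Local Notation E := (type2_equation u1 u2 v v1 v2).

Lemma type2_equation_nonconstant x0 x1 : I x0 -> I x1 -> u1 x0 != u1 x1 ->
  (forall x y, I x -> J y -> E x y = 0) ->
  exists a b c d, family_i I J u v a b c d.
Proof.
have [oI iI nI] := hI; have [oJ iJ nJ] := hJ.
move=> Ix0 Ix1 u01 E0.
pose G y := 1 + v1 y ^+ 2 + ty v v1 y ^+ 2.
(* The equations at y and z share [u2 x]. Cross-multiplying by [G] eliminates it and leaves a cubic
   in w = u1 x that vanishes on a whole interval; these are its coefficients, from degree 3 down to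
   0. *)
have coef y z : J y -> J z ->
  [/\ G z * v2 y = G y * v2 z, G z * (y * v2 y) = G y * (z * v2 z),
    G z * ((1 + 2 * y ^+ 2) * v2 y + ty v v1 y) =
    G y * ((1 + 2 * z ^+ 2) * v2 z + ty v v1 z) &
    G z * ((1 + y ^+ 2) * y / 2 * v2 y + v1 y + y * ty v v1 y) =
    G y * ((1 + z ^+ 2) * z / 2 * v2 z + v1 z + z * ty v v1 z)].
  move=> Jy Jz.
  have := @cubic_eq0 R
    (G z * ((1 + y ^+ 2) * y / 2 * v2 y + v1 y + y * ty v v1 y) -
     G y * ((1 + z ^+ 2) * z / 2 * v2 z + v1 z + z * ty v v1 z))
    (G z * ((1 + 2 * y ^+ 2) * v2 y + ty v v1 y) -
     G y * ((1 + 2 * z ^+ 2) * v2 z + ty v v1 z))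
    (5 / 2 * (G z * (y * v2 y) - G y * (z * v2 z)))
    (G z * v2 y - G y * v2 z) (u1 x0) (u1 x1 - u1 x0).
  rewrite subr_eq0 eq_sym => /(_ u01)[|h3 h2 h1 h0]; last by split; lra.
  move=> t t01 w; have [x Ix u1x] := has_derive_IVT iI is_u1 Ix0 Ix1 t01.
  have ey : G y * u2 x = (1 + (w + y) ^+ 2) * (w + y / 2) * v2 y + v1 y
      + (w + y) * ty v v1 y.
    have := E0 x y Ix Jy; rewrite /type2_equation /tx u1x -/w -/(G y); lra.
  have ez : G z * u2 x = (1 + (w + z) ^+ 2) * (w + z / 2) * v2 z + v1 z
      + (w + z) * ty v v1 z.
    have := E0 x z Ix Jz; rewrite /type2_equation /tx u1x -/w -/(G z); lra.
  have : G z * (G y * u2 x) - G y * (G z * u2 x) = 0 by ring.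
  by rewrite ey ez => <-; field.
have G_gt0 y : 0 < G y by rewrite /G -addrA ltr_pwDl// addr_ge0 ?sqr_ge0.
have v20 y : J y -> v2 y = 0.
  move=> Jy; have [z Jz zy] := open_other_point oJ Jy.
  have [h3 h2 _ _] := coef y z Jy Jz.
  (* Subtract z times the degree 3 identity from the degree 2 identity. *)
  have : (G z * v2 y) * (y - z) = 0.
    by rewrite mulrBr {2}h3; move: h2; lra.
  move/eqP; rewrite !mulf_eq0 subr_eq0 [y == z]eq_sym (negbTE zy) orbF.
  by rewrite (gt_eqF (G_gt0 _)) => /eqP.
have [y0 Jy0] := nJ.
have v1E y : J y -> v1 y = v1 y0.
  move=> Jy; apply: (has_derive0_cst iJ) => // s Js.
  by rewrite -(v20 s Js); exact: is_v1.
have qE y : J y -> ty v v1 y = ty v v1 y0.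
  move=> Jy; apply: (has_derive0_cst iJ) => // s Js.
  have h0 := is_v Js; have h1 := is_v1 Js.
  by rewrite /ty; compute_derive; rewrite v20//; ring.
have q0 : ty v v1 y0 = 0.
  have [z Jz zy] := open_other_point oJ Jy0.
  (* With v'' = 0 and with v', [ty] and [G] constant, the two sides of the degree 0 identity differ
     by a multiple of Q (z - y0). *)
  have [_ _ _] := coef y0 z Jy0 Jz; rewrite !v20// v1E// qE//.
  have -> : G z = G y0 by rewrite /G v1E// qE.
  move: (ty v v1 y0) (G y0) (G_gt0 y0) => Q g g0 h.
  have : g * (Q * (z - y0)) = 0 by lra.
  move/eqP; rewrite !mulf_eq0 subr_eq0 (negbTE zy) orbF.
  by rewrite (gt_eqF g0) => /eqP.
set a := v1 y0.
have a0 : 1 + a ^+ 2 != 0 by rewrite gt_eqF// ltr_pwDl// sqr_ge0.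
(* [ty] = 0 reads v = y v', which leaves no additive constant; hence the witness d = 0 below. *)
have vE y : J y -> v y = a * y.
  by move=> Jy; have := qE y Jy; rewrite q0 /ty v1E// -/a; lra.
have u2E x : I x -> u2 x = a / (1 + a ^+ 2).
  move=> Ix; have := E0 x y0 Ix Jy0.
  rewrite /type2_equation v20// q0 -/a => h.
  by apply: (mulIf a0); rewrite divfK//; move: h; lra.
have [b u1E] : exists b, forall x, I x -> u1 x = a / (1 + a ^+ 2) * x + b.
  apply: (primitive_unique iI nI is_u1) => x Ix.
  by compute_derive; rewrite u2E//; field.
have [c uE] : exists c, forall x, I x ->
    u x = a / (2 * (1 + a ^+ 2)) * x ^+ 2 + b * x + c.
  apply: (primitive_unique iI nI is_u) => x Ix.
  by compute_derive; rewrite u1E//; field.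
by exists a, b, c, 0; split => // y Jy; rewrite vE// addr0.
Qed.

Lemma sqrtS_gt0 (s : R) : 0 < 1 + s ^+ 2.
Proof. by rewrite ltr_pwDl// sqr_ge0. Qed.

(** Since - s <= |s| = sqrt (s^2) < sqrt (1 + s^2). This makes the logarithm in family (ii)
    differentiable. *)
Lemma add_sqrt_gt0 (s : R) : 0 < s + Num.sqrt (1 + s ^+ 2).
Proof.
rewrite -[s in s + _]opprK addrC subr_gt0.
apply: le_lt_trans (ler_norm _) _; rewrite normrN -sqrtr_sqr.
by rewrite ltr_sqrt ?sqrtS_gt0// ltrDr.
Qed.

(** Twice a primitive of sqrt (1 + (a + y)^2); the logarithm is arsinh (a + y). *)
Definition sqrt1_int (a y : R) : R :=
  (a + y) * Num.sqrt (1 + (a + y) ^+ 2)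
  + ln (a + y + Num.sqrt (1 + (a + y) ^+ 2)).

Lemma has_derive_sqrt1 (a y : R) :
  has_derive (fun y => Num.sqrt (1 + (a + y) ^+ 2)) y
    ((a + y) / Num.sqrt (1 + (a + y) ^+ 2)).
Proof.
have h : has_derive (fun y => 1 + (a + y) ^+ 2) y (2 * (a + y)).
  by compute_derive; ring.
apply: has_derive_eq; first exact: (has_derive_sqrt h (sqrtS_gt0 _)).
by field; rewrite gt_eqF// sqrtr_gt0 sqrtS_gt0.
Qed.

Lemma has_derive_sqrt1_int (a y : R) :
  has_derive (sqrt1_int a) y (2 * Num.sqrt (1 + (a + y) ^+ 2)).
Proof.
have hs := has_derive_sqrt1 a y.
have h : has_derive (fun y => a + y + Num.sqrt (1 + (a + y) ^+ 2)) y
    (1 + (a + y) / Num.sqrt (1 + (a + y) ^+ 2)) by compute_derive; ring.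
have hl := has_derive_ln h (add_sqrt_gt0 _).
rewrite /sqrt1_int; compute_derive.
have s0 : Num.sqrt (1 + (a + y) ^+ 2) != 0.
  by rewrite gt_eqF// sqrtr_gt0 sqrtS_gt0.
have ss0 : a + y + Num.sqrt (1 + (a + y) ^+ 2) != 0.
  by rewrite gt_eqF// add_sqrt_gt0.
have : Num.sqrt (1 + (a + y) ^+ 2) ^+ 2 = 1 + (a + y) ^+ 2.
  by rewrite sqr_sqrtr ?ltW ?sqrtS_gt0.
move: s0 ss0; set s := Num.sqrt _ => s0 ss0 s2.
(* The derivative of arsinh. *)
have -> : (1 + (a + y) / s) / (a + y + s) = s^-1 by field; rewrite ss0 s0.
apply: (mulIf s0); rewrite mulrDl mulVf//.
have -> : ((0 + 1) * s + (a + y) * ((a + y) / s)) * s = s ^+ 2 + (a + y) ^+ 2.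
  by field.
by rewrite -mulrA -expr2 s2; ring.
Qed.

Lemma type2_equation_constant a :
  (forall x, I x -> u1 x = a) ->
  (forall x y, I x -> J y -> E x y = 0) ->
  exists a u0 b c, family_ii I J u v a u0 b c.
Proof.
move=> u1a E0; have [oI iI nI] := hI; have [oJ iJ nJ] := hJ.
have [x0 Ix0] := nI.
have u20 : u2 x0 = 0.
  apply: (has_derive_unique (is_u1 Ix0)).
  by apply: (has_derive_open oI Ix0 _ (has_deriveC x0 a)) => s /u1a.
have [u0 uE] : exists u0, forall x, I x -> u x = a * x + u0.
  apply: (primitive_unique iI nI is_u) => x Ix.
  by compute_derive; rewrite u1a//; ring.
pose sq y := Num.sqrt (1 + (a + y) ^+ 2).
have sq0 y : sq y != 0 by rewrite gt_eqF// sqrtr_gt0 sqrtS_gt0.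
have sq2 y : sq y ^+ 2 = 1 + (a + y) ^+ 2 by rewrite sqr_sqrtr ?ltW ?sqrtS_gt0.
pose w y := (2 * a + y) * v y.
pose w1 y := v y + (2 * a + y) * v1 y.
have is_w y : J y -> has_derive w y (w1 y).
  move=> Jy; have h0 := is_v Jy.
  by rewrite /w /w1; compute_derive; ring.
(* With s = a + y, the equation (1 + s^2) w'' = s w' says that w' / sqrt (1 + s^2) has derivative
   0. *)
have is_phi y : J y -> has_derive (fun t => w1 t / sq t) y 0.
  move=> Jy; have h0 := is_v Jy; have h1 := is_v1 Jy.
  have hs := has_deriveV (has_derive_sqrt1 a y) (sq0 y).
  rewrite /w1; compute_derive.
  have := E0 x0 y Ix0 Jy; rewrite /type2_equation /tx /ty u20 u1a// => e.
  move: (sq0 y) (sq2 y); rewrite /sq; set s := Num.sqrt _ => s0 s2.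
  apply: (mulIf (expf_neq0 3 s0)); rewrite mul0r.
  set A := (X in X * _ = 0).
  (* Clearing denominators gives (1 + (a + y)^2) w'' - (a + y) w', which is - 2 times the minimality
     equation. *)
  have -> : A * s ^+ 3 = s ^+ 2 * (2 * v1 y + (2 * a + y) * v2 y)
      - (a + y) * (v y + (2 * a + y) * v1 y) by rewrite /A; field.
  by rewrite s2; move: e; lra.
have [y0 Jy0] := nJ.
pose c := w1 y0 / sq y0.
have w1E y : J y -> w1 y = c * sq y.
  move=> Jy; rewrite /c -(has_derive0_cst iJ is_phi Jy Jy0).
  by rewrite divfK.
have [b wE] : exists b, forall y, J y -> w y = c / 2 * sqrt1_int a y + b.
  apply: (primitive_unique iJ nJ is_w) => y Jy.
  have h := has_derive_sqrt1_int a y.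
  by compute_derive; rewrite w1E// /sq; field.
exists a, u0, b, c; split => // y Jy y0'.
by apply: (mulfI y0'); rewrite -/(w y) wE// /sqrt1_int; field.
Qed.

(** With d = 0 the function [ty] vanishes, so the equation reduces to (1 + a^2) u'' = a. *)
Lemma family_i_equation a b c : family_i I J u v a b c 0 ->
  forall x y, I x -> J y -> E x y = 0.
Proof.
move=> [uE vE] x y Ix Jy; have [oI _ _] := hI; have [oJ _ _] := hJ.
have a0 : 1 + a ^+ 2 != 0 by rewrite gt_eqF// sqrtS_gt0.
have u1E s : I s -> u1 s = a / (1 + a ^+ 2) * s + b.
  move=> Is; apply: (has_derive_unique (is_u Is)).
  apply: (has_derive_open oI Is (fun s Is => esym (uE s Is))).
  by compute_derive; field.
have u2E : u2 x = a / (1 + a ^+ 2).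
  apply: (has_derive_unique (is_u1 Ix)).
  apply: (has_derive_open oI Ix (fun s Is => esym (u1E s Is))).
  by compute_derive; field.
have v1E t : J t -> v1 t = a.
  move=> Jt; apply: (has_derive_unique (is_v Jt)).
  apply: (has_derive_open oJ Jt (fun s Js => esym (vE s Js))).
  by compute_derive; ring.
have v2E : v2 y = 0.
  apply: (has_derive_unique (is_v1 Jy)).
  apply: (has_derive_open oJ Jy (fun s Js => esym (v1E s Js))).
  exact: has_deriveC.
by rewrite /type2_equation /ty u2E v2E v1E// vE//; field.
Qed.

(** The product w = (2 a + y) v has no pole, so its formula holds on all of [J] and may be
    differentiated twice; this yields the differential equation for w. *)
Lemma family_ii_equation a u0 b c : family_ii I J u v a u0 b c ->
  forall x y, I x -> J y -> E x y = 0.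
Proof.
move=> [uE vE] x y Ix Jy; have [oI _ _] := hI; have [oJ _ _] := hJ.
have u1E s : I s -> u1 s = a.
  move=> Is; apply: (has_derive_unique (is_u Is)).
  apply: (has_derive_open oI Is (fun s Is => esym (uE s Is))).
  by compute_derive; ring.
have u2E : u2 x = 0.
  apply: (has_derive_unique (is_u1 Ix)).
  apply: (has_derive_open oI Ix (fun s Is => esym (u1E s Is))).
  exact: has_deriveC.
pose w y := (2 * a + y) * v y.
pose w1 y := v y + (2 * a + y) * v1 y.
have is_w t : J t -> has_derive w t (w1 t).
  move=> Jt; have h0 := is_v Jt.
  by rewrite /w /w1; compute_derive; ring.
have is_S t : has_derive (fun t => b + c / 2 * sqrt1_int a t) t
    (c * Num.sqrt (1 + (a + t) ^+ 2)).
  by have h := has_derive_sqrt1_int a t; compute_derive; field.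
have wE t : J t -> w t = b + c / 2 * sqrt1_int a t.
  have off s : J s -> s != - (2 * a) -> w s = b + c / 2 * sqrt1_int a s.
    move=> Js sa; have s0 : 2 * a + s != 0 by rewrite addrC addr_eq0.
    by rewrite /w vE// /sqrt1_int; field.
  (* At the pole t = - 2 a, where the formula is void, use continuity. *)
  move=> Jt; have [ta|] := eqVneq t (- (2 * a)); last exact: off.
  apply: (continuous_punctured_eq (f := w)
    (g := fun t => b + c / 2 * sqrt1_int a t) oJ Jt).
  - exact: has_derive_continuous (is_w t Jt).
  - exact: has_derive_continuous (is_S t).
  - by rewrite ta.
have w1E t : J t -> w1 t = c * Num.sqrt (1 + (a + t) ^+ 2).
  move=> Jt; apply: (has_derive_unique (is_w t Jt)).
  exact: (has_derive_open oJ Jt (fun s Js => esym (wE s Js)) (is_S t)).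
have w2E : 2 * v1 y + (2 * a + y) * v2 y =
    c * ((a + y) / Num.sqrt (1 + (a + y) ^+ 2)).
  have h0 := is_v Jy; have h1 := is_v1 Jy.
  apply: (has_derive_unique (f := w1) (x := y)).
    by rewrite /w1; compute_derive; ring.
  apply: (has_derive_open oJ Jy (fun s Js => esym (w1E s Js))).
  have hs := has_derive_sqrt1 a y.
  by compute_derive; ring.
have s0 : Num.sqrt (1 + (a + y) ^+ 2) != 0.
  by rewrite gt_eqF// sqrtr_gt0 sqrtS_gt0.
have s2 : Num.sqrt (1 + (a + y) ^+ 2) ^+ 2 = 1 + (a + y) ^+ 2.
  by rewrite sqr_sqrtr ?ltW ?sqrtS_gt0.
have := w1E y Jy; rewrite /w1; move: w2E s0 s2.
set s := Num.sqrt _ => w2E s0 s2 {}w1E.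
(* This is (1 + s^2) w'' = s w' with s = a + y, in terms of v; divided by - 2 it is the equation
   sought. *)
have ode : (1 + (a + y) ^+ 2) * (2 * v1 y + (2 * a + y) * v2 y) =
    (a + y) * (v y + (2 * a + y) * v1 y).
  by rewrite w1E w2E -s2; field.
by rewrite /type2_equation /tx /ty u2E u1E//; move: ode; lra.
Qed.

End Classification.

Theorem theorem3p4 (R : realType) (I J : set R) (u v : R -> R)
    (hI : open_interval I) (hJ : open_interval J)
    (hu : smooth_on I u) (hv : smooth_on J v) :
  (forall x y : R, I x -> J y ->
     type2_surface u v x y = pt (x + v y) y (u x + x * y / 2)) /\
  (minimal_surface nil_metric I J (type2_surface u v) ->
     (exists a b c d : R, family_i I J u v a b c d) \/
     (exists a u0 b c : R, family_ii I J u v a u0 b c)) /\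
  (forall a b c d : R, family_i I J u v a b c d -> d = 0 ->
     minimal_surface nil_metric I J (type2_surface u v)) /\
  (forall a u0 b c : R, family_ii I J u v a u0 b c ->
     minimal_surface nil_metric I J (type2_surface u v)).
Proof.
have is_u x (Ix : I x) := has_derive_smooth 0 hu Ix.
have is_u1 x (Ix : I x) := has_derive_smooth 1 hu Ix.
have is_v y (Jy : J y) := has_derive_smooth 0 hv Jy.
have is_v1 y (Jy : J y) := has_derive_smooth 1 hv Jy.
have [[oI _ [x0 Ix0]] [oJ _ _]] := (hI, hJ).
have minimalP := minimal_type2 oI oJ is_u is_u1 is_v is_v1.
split=> [x y _ _|]; first exact: type2_surfaceE.
split; last split.
- move=> /minimalP E0.
  have [u1a|] := pselect (forall x, I x -> derive1n 1 u x = derive1n 1 u x0).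
    right; exact: (type2_equation_constant hI hJ is_u is_u1 is_v is_v1 u1a E0).
  move=> /existsNP[x /not_implyP[Ix /eqP ux]]; left.
  exact: (type2_equation_nonconstant hI hJ is_u is_u1 is_v is_v1 Ix Ix0 ux E0).
- move=> a b c d + d0; rewrite d0 => fam; apply/minimalP.
  exact: (family_i_equation hI hJ is_u is_u1 is_v is_v1 fam).
- move=> a u0 b c fam; apply/minimalP.
  exact: (family_ii_equation hI hJ is_u is_u1 is_v is_v1 fam).
Qed.
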